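(* For every integer $n \ge 3$, the optimal pegging number of the cycle $C_n$ is $p(C_n)=\lceil n/2\rceil$.
   Context: $C_n$ is the cycle on $n$ vertices. A distribution of pegs on a graph $G$ is a subset $D \subseteq V(G)$. If $u,v \in D$ are distinct adjacent vertices and $w \notin D$ is a vertex adjacent to $v$, the pegging move (jumping $u$ over $v$ into $w$) replaces $D$ by $(D\setminus\{u,v\})\cup\{w\}$. A vertex $t$ is reachable from $D$ if some finite (possibly empty) sequence of pegging moves starting from $D$ ends in a distribution containing $t$; $\mathrm{Reach}(D)$ is the set of reachable vertices. The optimal pegging number $p(G)$ is the smallest positive integer $d$ such that some distribution of size $d$ on $G$ has reach $V(G)$. *)

(* Defs.v *)
From mathcomp Require Import all_boot.

Set Implicit Arguments.
Unset Strict Implicit.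
Unset Printing Implicit Defensive.

Section Pegging.

Variables (T : finType) (e : rel T).

Definition peg_move : rel {set T} := fun D D' =>
  [exists u, exists v, exists w,
    [&& u \in D, v \in D, u != v, e u v, w \notin D, e v w
      & D' == w |: (D :\: [set u; v])]].

(* [connect] is the reflexive transitive closure: finite, possibly empty,
   sequences of moves. *)
Definition peg_reach (D : {set T}) : {set T} :=
  [set t | [exists D', connect peg_move D D' && (t \in D')]].

Definition full_reach_size (d : nat) : Prop :=
  exists2 D : {set T}, #|D| = d & peg_reach D = [set: T].

(* "p(G) = d", where G is the graph with vertex type T and adjacency e. *)
Definition is_optimal_pegging_number (d : nat) : Prop :=
  [/\ 0 < d, full_reach_size d
    & forall d', 0 < d' -> full_reach_size d' -> d <= d'].

Lemma is_optimal_pegging_number_inj d1 d2 :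
  is_optimal_pegging_number d1 -> is_optimal_pegging_number d2 -> d1 = d2.
Proof.
move=> [p1 r1 m1] [p2 r2 m2]; apply/eqP; rewrite eqn_leq.
by rewrite m1 // m2.
Qed.

End Pegging.

Definition cycle_graph (n : nat) : rel 'I_n :=
  fun i j => (i.+1 %% n == j) || (j.+1 %% n == i).

Lemma cycle_graph_sym n : symmetric (cycle_graph (n := n)).
Proof. by move=> i j; rewrite /cycle_graph orbC. Qed.

Lemma cycle_graph_irrefl n : 1 < n -> irreflexive (cycle_graph (n := n)).
Proof.
move=> n_gt1 i; rewrite /cycle_graph orbb.
have [lt_in|] := ltnP i.+1 n; first by rewrite modn_small // gtn_eqF.
rewrite leq_eqVlt ltnNge (ltn_ord i) orbF => /eqP def_n.
by rewrite -def_n modnn; case: (nat_of_ord i) def_n n_gt1 => // ->.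
Qed.

Arguments cycle_graph : clear implicits.

(* Main.v *)
(** Until a hole [t] is first filled, no jump crosses it, so playing backwards
    shows that [t] is reachable only if, in one of the two directions, the
    vertices at distances 1, 3, ..., 2k+1 and 2k+2 from [t] all carry pegs.
    Assuming that every vertex is reachable, map each hole [t] to its
    predecessor if that is a peg, and otherwise to the vertex at distance 2k+1
    after [t], which is a peg followed by a peg.  This map from holes to pegs is
    injective, so at least half of the vertices carry pegs.  Conversely, pegs at
    0, 1, 3, 5, ... reach everything: the adjacent pair moves two steps forward
    with each jump, filling all the even vertices. *)

Require Import Defs.
From mathcomp Require Import all_boot.
From mathcomp Require Import zify.

Set Implicit Arguments.
Unset Strict Implicit.
Unset Printing Implicit Defensive.

Section SuccessorGraph.

Variables (T : finType) (s p : T -> T).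
Hypothesis sK : cancel s p.

Definition succ_edge : rel T := fun u v => (s u == v) || (s v == u).

(** By injectivity of [s], changing direction at [v] would lead back to [u]. *)
Lemma succ_edge_jump u v w : succ_edge u v -> succ_edge v w -> u != w ->
  (v = s u /\ w = s v) \/ (v = p u /\ w = p v).
Proof.
move=> /orP[/eqP<-|/eqP<-] /orP[/eqP<-|/eqP E] uw; [by left| | |].
- by rewrite (can_inj sK E) eqxx in uw.
- by rewrite eqxx in uw.
- by right; rewrite -E !sK.
Qed.

End SuccessorGraph.

Lemma peg_moveP (T : finType) (e : rel T) (D D' : {set T}) :
  peg_move e D D' -> exists u v w,
    [/\ [/\ u \in D, v \in D & w \notin D], e u v, e v w, u != w
      & D' = w |: (D :\: [set u; v])].
Proof.
case/existsP=> u /existsP[v /existsP[w /and5P[uD vD _ euv]]].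
case/and3P=> wD evw /eqP defD'; exists u, v, w; split=> //.
by apply: contraNneq wD => <-.
Qed.

Definition ladder (T : finType) (s : T -> T) (D : {set T}) (t : T) : Prop :=
  exists k, (forall i, i <= k -> iter i.*2.+1 s t \in D)
            /\ iter k.*2.+2 s t \in D.

(** Only the landing vertex [w] can be on the ladder in [D'] without being in [D]. At an odd
    distance it would force [v = t], or put [u] or [v], both empty in [D'], on the ladder. So it can
    only be the top, and undoing the jump then extends the ladder by two. *)
Lemma ladder_move (T : finType) (s p : T -> T) (D D' : {set T}) (t : T) :
    cancel s p -> cancel p s -> peg_move (succ_edge s) D D' ->
  t \notin D -> ladder s D' t -> ladder s D t.
Proof.
move=> sK pK /peg_moveP[u [v [w [[uD vD wD] euv evw uw defD']]]] tD.
case=> k [odd_k top_k].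
have uD' : u \notin D' by rewrite defD' !inE eqxx /= orbF.
have vD' : v \notin D'.
  by rewrite defD' !inE eqxx orbT /= orbF; apply: contraNneq wD => <-.
have stay x : x \in D' -> x != w -> x \in D.
  by rewrite defD' !inE => /orP[->//|/andP[]].
have jump := succ_edge_jump sK euv evw uw.
have odd_w i : i <= k -> iter i.*2.+1 s t != w.
  move=> le_ik; apply/eqP=> defw; case: jump => -[defv defw'].
  - have defv' : v = iter i.*2 s t by apply: (can_inj sK); rewrite -defw' -defw.
    case: i le_ik defw defv' => [|i] le_ik _ defv'.
      by rewrite defv' in vD; rewrite vD in tD.
    have defu : u = iter i.*2.+1 s t by apply: (can_inj sK); rewrite -defv defv'.
    by rewrite defu odd_k ?(ltnW le_ik) in uD'.
  - have defv' : v = iter i.*2.+2 s t by rewrite iterS defw defw' pK.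
    have defu : u = iter i.+1.*2.+1 s t by rewrite doubleS iterS -defv' defv pK.
    move: le_ik; rewrite leq_eqVlt => /orP[/eqP def_i|lt_ik].
      by rewrite defv' def_i top_k in vD'.
    by rewrite defu odd_k in uD'.
have oddD i : i <= k -> iter i.*2.+1 s t \in D.
  by move=> le_ik; apply: stay; [apply: odd_k | apply: odd_w].
have [defw|/(stay _ top_k) topD] := eqVneq (iter k.*2.+2 s t) w; last by exists k.
case: jump => -[defv defw'].
  have defv' : v = iter k.*2.+1 s t by apply: (can_inj sK); rewrite -defw' -defw.
  by rewrite defv' odd_k in vD'.
have defv' : v = iter k.+1.*2.+1 s t by rewrite doubleS iterS defw defw' pK.
have defu : u = iter k.+1.*2.+2 s t by rewrite iterS -defv' defv pK.
exists k.+1; split; last by rewrite -defu.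
move=> i; rewrite leq_eqVlt => /orP[/eqP->|lt_ik]; first by rewrite -defv'.
exact: oddD.
Qed.

Lemma succ_edgeC (T : finType) (s p : T -> T) :
  cancel s p -> cancel p s -> succ_edge p =2 succ_edge s.
Proof.
move=> sK pK u v; rewrite /succ_edge orbC.
rewrite -(inj_eq (can_inj sK)) pK -(inj_eq (can_inj sK) (p u)) pK.
by rewrite ![_ == s _]eq_sym.
Qed.

Lemma eq_peg_move (T : finType) (e e' : rel T) : e =2 e' ->
  peg_move e =2 peg_move e'.
Proof.
move=> ee' D D'; apply: eq_existsb => u; apply: eq_existsb => v.
by apply: eq_existsb => w; rewrite !ee'.
Qed.

Lemma reach_ladder (T : finType) (s p : T -> T) (D : {set T}) (t : T) :
    cancel s p -> cancel p s -> t \in peg_reach (succ_edge s) D ->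
  [\/ t \in D, ladder s D t | ladder p D t].
Proof.
move=> sK pK; rewrite inE => /existsP[D'' /andP[/connectP[l]]].
elim: l D => [D _ -> | D' l IHl D /=]; first by constructor 1.
case/andP=> mv /IHl{}IHl lastD tD''.
have [tD|tD] := boolP (t \in D); first by constructor 1.
case: (IHl lastD tD'') => [tD'|lad|lad].
(* This move fills [t], so [v] and [u] are at distances 1 and 2 from [t]: a ladder with [k = 0], on
   the side the jump came from. *)
- have [u [v [w [[uD vD wD] euv evw uw defD']]]] := peg_moveP mv.
  move: tD'; rewrite defD' !inE (negbTE tD) andbF orbF => /eqP deft.
  case: (succ_edge_jump sK euv evw uw) => -[defv defw].
  + constructor 3; exists 0; rewrite deft defw defv /= !sK -defv.
    by split=> // -[|//] _ /=; rewrite sK.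
  + constructor 2; exists 0; rewrite deft defw defv /= !pK -defv.
    by split=> // -[|//] _ /=; rewrite pK.
- by constructor 2; apply: (ladder_move sK pK mv).
- constructor 3; apply: (ladder_move pK sK _ tD lad).
  by rewrite (eq_peg_move (succ_edgeC sK pK)).
Qed.

Lemma iter_inj (T : Type) (f : T -> T) m : injective f -> injective (iter m f).
Proof. by move=> f_inj; elim: m => //= m IHm x y /f_inj/IHm. Qed.

Lemma full_reach_card (T : finType) (s p : T -> T) (D : {set T}) :
    cancel s p -> cancel p s -> peg_reach (succ_edge s) D = [set: T] ->
  #|T| <= #|D|.*2.
Proof.
move=> sK pK full.
(* The clause [s x \in D] keeps [x] apart from the predecessor of any hole. *)
pose climb t x := [/\ p t \notin D, s x \in D & exists2 k, x = iter k.*2.+1 s t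
  & forall i, i <= k -> iter i.*2.+1 s t \in D].
have /fin_all_exists[f f_spec] : forall t, exists x,
    t \notin D -> x \in D /\ (x = p t \/ climb t x).
  move=> t; have [ptD|ptD] := boolP (p t \in D); first by exists (p t); split; [|left].
  have := in_setT t; rewrite -full.
  case/(reach_ladder sK pK)=> [tD|[k [oddk topk]]|[k [oddk _]]].
  - by exists t; rewrite tD.
  - exists (iter k.*2.+1 s t) => _; split; first exact: oddk.
    by right; split=> //; exists k.
  - by have := oddk 0 isT; rewrite (negbTE ptD).
(* Here [t'] lies [(k - k').*2] steps after [t]; if this is positive, [p t'] is at an odd distance
   at most [k.*2.+1] from [t], hence a peg. *)
have climb_inj t t' x k k' : p t' \notin D -> k' <= k ->
    x = iter k.*2.+1 s t -> x = iter k'.*2.+1 s t' ->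
    (forall i, i <= k -> iter i.*2.+1 s t \in D) -> t = t'.
  move=> pt' le_k'k -> eq_iter oddk.
  have {}eq_iter : iter (k - k').*2 s t = t'.
    apply: (iter_inj (m := k'.*2.+1) (can_inj sK)).
    by rewrite -eq_iter -iterD; congr (iter _ s t); lia.
  case def_d: (k - k') eq_iter => [|d] // deft'.
  by case/negP: pt'; rewrite -deft' doubleS iterS sK oddk //; lia.
have f_inj : {in ~: D &, injective f}.
  move=> t t'; rewrite !inE => tD t'D eqf.
  have [_ ft] := f_spec t tD; have [_ ft'] := f_spec t' t'D; rewrite -eqf in ft'.
  case: ft ft' => [-> |[pt sD [k defk oddk]]] [E|[pt' sD' [k' defk' oddk']]].
  - exact: (can_inj pK).
  - by rewrite pK (negbTE tD) in sD'.
  - by rewrite E pK (negbTE t'D) in sD.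
  - case/orP: (leq_total k' k) => le_k; first exact: climb_inj defk defk' oddk.
    by apply/esym; apply: climb_inj defk' defk oddk'.
have : #|f @: ~: D| <= #|D|.
  apply/subset_leq_card/subsetP => _ /imsetP[t tD ->].
  by rewrite inE in tD; case: (f_spec t tD).
by rewrite (card_in_imset f_inj) -(cardsC D); lia.
Qed.

Section Staircase.

Variables (n : nat) (n_ge3 : 3 <= n).

(** The position after [k] jumps. The bound [x.+1 < n] matters for even [n], where a peg at [n - 1]
    would be one too many. *)
Definition staircase (k : nat) : {set 'I_n} :=
  [set x : 'I_n | (x == k.*2 :> nat) || [&& odd x, k.*2 < x & x.+1 < n]].

Lemma card_staircase0 : #|staircase 0| = uphalf n.
Proof.
(* The map [i.*2.-1] lists 0, 1, 3, 5, ..., with truncation at [i = 0]; [uphalf] inverts it. *)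
have lt_f (i : 'I_(uphalf n)) : i.*2.-1 < n by have := ltn_ord i; lia.
pose f i := Ordinal (lt_f i).
have f_inj : injective f by move=> i j [E]; apply: val_inj => /=; lia.
rewrite -[RHS]card_ord -(card_imset _ f_inj); apply: eq_card => x.
rewrite !inE; apply/idP/imsetP => [Dx|[i _ ->] /=]; last by have := ltn_ord i; lia.
have lt_i : uphalf x < uphalf n by have := ltn_ord x; lia.
by exists (Ordinal lt_i) => //; apply: val_inj => /=; lia.
Qed.

Lemma cycle_graph_succ (i j : 'I_n) : j = i.+1 :> nat -> cycle_graph n i j.
Proof. by move=> def_j; rewrite /cycle_graph modn_small -def_j ?eqxx. Qed.

Lemma staircase_move k : k.*2.+2 < n ->
  peg_move (cycle_graph n) (staircase k) (staircase k.+1).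
Proof.
move=> w_lt; have v_lt := ltnW w_lt; have u_lt := ltnW v_lt.
apply/existsP; exists (Ordinal u_lt); apply/existsP; exists (Ordinal v_lt).
apply/existsP; exists (Ordinal w_lt).
rewrite !cycle_graph_succ // !inE -(val_eqE (Ordinal u_lt)) /=.
apply/and5P; split; [lia|lia|lia|lia|apply/eqP/setP=> x].
by rewrite !inE -!val_eqE /=; lia.
Qed.

Lemma staircase_connect k : k.*2 < n ->
  connect (peg_move (cycle_graph n)) (staircase 0) (staircase k).
Proof.
elim: k => [|k IHk] lt_k; first exact: connect0.
apply: connect_trans (IHk _) (connect1 (staircase_move _)); lia.
Qed.

Lemma staircase_full : peg_reach (cycle_graph n) (staircase 0) = [set: 'I_n].
Proof.
apply/setP=> t; rewrite !inE; apply/existsP.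
have [odd_t|even_t] := boolP (odd t); last first.
  exists (staircase t./2); rewrite staircase_connect ?inE; have := ltn_ord t; lia.
have [lt_t|le_n] := ltnP t.+1 n.
  by exists (staircase 0); rewrite connect0 inE odd_t lt_t; lia.
(* What remains is the last vertex for even [n]: peg 1 jumps backwards over 0 into it. *)
have def_n : t.+1 = n by have := ltn_ord t; lia.
have lt0 : 0 < n by lia.
have lt1 : 1 < n by lia.
pose v := Ordinal lt0; pose u := Ordinal lt1.
exists (t |: (staircase 0 :\: [set u; v])); rewrite setU11 andbT; apply: connect1.
apply/existsP; exists u; apply/existsP; exists v; apply/existsP; exists t.
rewrite cycle_graph_sym cycle_graph_succ // eqxx !inE -!val_eqE /=.
rewrite /cycle_graph /= def_n modnn eqxx orbT; lia.
Qed.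

End Staircase.

(* uphalf n = n.+1./2 is the ceiling of n / 2. *)
Theorem theorem3p2 (n : nat) (n_ge3 : 3 <= n) :
  is_optimal_pegging_number (cycle_graph n) (uphalf n).
Proof.
split; first by lia.
- by exists (staircase n 0); [exact: card_staircase0 | exact: staircase_full].
- move=> d _ [D <- full].
  (* [cycle_graph n] is convertible to [succ_edge] of the cyclic successor [ordS]. *)
  have := full_reach_card (@ordSK n) (@ord_predK n) full.
  by rewrite card_ord; lia.
Qed.
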